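(* Let $n,d\ge1$ and let $P_1,\dots,P_d$ be independent uniformly random $n\times n$ permutation matrices; put $M_\Lambda=P_1+\cdots+P_d$, the adjacency matrix of a random $d$-regular directed multigraph $\Lambda$ on $[n]$. For $A,B\subset[n]$ let $e_\Lambda(A,B)=\sum_{i\in A,\,j\in B}M_\Lambda(i,j)$ be the number of directed edges from $A$ to $B$ counted with multiplicity, and let $\mu=\frac{d}{n}|A||B|$. Then for any $\tau\ge0$, $$\mathbb{P}\big(|e_\Lambda(A,B)-\mu|\ge\tau\mu\big)\le 2\exp\!\left(-\frac{\tau^2\mu}{2+\tau}\right).$$ *)

(* Defs.v *)
From HB Require Import structures.
From mathcomp Require Import all_boot all_order all_algebra all_fingroup.
From mathcomp Require Import all_classical all_reals all_analysis.

Set Implicit Arguments.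
Unset Strict Implicit.
Unset Printing Implicit Defensive.

Import Order.TTheory GRing.Theory Num.Theory.
Import numFieldNormedType.Exports.

Local Open Scope classical_set_scope.
Local Open Scope ring_scope.

(* Since X takes its values in the finite set of permutation matrices, the
   measurability of the fibers over that set makes every preimage under X
   measurable. *)
Definition uniform_perm_mx (R : realType) (disp : measure_display)
    (T : measurableType disp) (Pr : probability T R) (n : nat)
    (X : T -> 'M[R]_n) : Prop :=
  (forall w : T, is_perm_mx (X w)) /\
  (forall s : 'S_n,
     measurable (X @^-1` [set perm_mx s]) /\
     Pr (X @^-1` [set perm_mx s]) = ((n`!)%:R^-1)%:E).

(* Mutual independence of random elements with finitely many values, i.e. with
   respect to the discrete sigma-algebra: the sets B k are arbitrary. *)
Definition mutually_independent (R : realType) (disp : measure_display)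
    (T : measurableType disp) (Pr : probability T R) (I : finType) (V : Type)
    (X : I -> T -> V) : Prop :=
  forall (J : {set I}) (B : I -> set V),
    Pr (\bigcap_(k in [set` J]) (X k @^-1` B k)) =
    (\prod_(k in J) Pr (X k @^-1` B k))%E.

Definition edge_count (R : realType) (n : nat) (M : 'M[R]_n)
    (A B : {set 'I_n}) : R :=
  \sum_(i in A) \sum_(j in B) M i j.

(* Main.v *)
(** Conditionally on a permutation mapping S into B, a further point i outside S
    lands in B with probability (|B|-|S|)/(n-|S|) <= |B|/n. Hence for y >= 1 the
    generating function at y of the number of i in A mapped into B is at most
    the binomial one, (1 + |B|/n (y-1))^|A| <= exp(|A||B|/n (y-1)); replacing B
    by its complement extends this to 0 < y < 1. By independence the d
    generating functions multiply, and Markov's inequality at y = 1+tau for the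
    upper tail and at y = 1/(1+tau) for the lower tail gives the bound, thanks to
    2 (y-1)/(y+1) <= ln y <= (y - 1/y)/2 for y >= 1. *)
Require Import Defs.
From HB Require Import structures.
From mathcomp Require Import all_boot all_order all_algebra all_fingroup.
From mathcomp Require Import all_classical all_reals all_analysis.
From mathcomp Require Import ring lra.

Import Order.TTheory GRing.Theory Num.Theory.
Import numFieldNormedType.Exports.

Local Open Scope ring_scope.

Set Implicit Arguments.
Unset Strict Implicit.
Unset Printing Implicit Defensive.

(** * Generating function of the number of points mapped into a set *)

Definition perms_into (I : finType) (S B : {set I}) : {set {perm I}} :=
  [set s : {perm I} | s @: S \subset B].

(** Precomposing with the transposition of [i] and [j], which fixes [S] pointwise, injects each
    family into the other. *)
Lemma card_perms_into_setU1_eq (I : finType) (S B : {set I}) (i j : I) :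
  i \notin S -> j \notin S ->
  #|perms_into (i |: S) B| = #|perms_into (j |: S) B|.
Proof.
move=> iS jS.
have le k l : k \notin S -> l \notin S ->
    (#|perms_into (k |: S) B| <= #|perms_into (l |: S) B|)%N.
  move=> kS lS; rewrite -(card_imset _ (mulgI (tperm k l))).
  apply/subset_leq_card/fintype.subsetP=> _ /imsetP[s + ->].
  rewrite !inE => /fintype.subsetP sB; apply/fintype.subsetP=> _ /imsetP[x + ->].
  rewrite !inE permM => /orP[/eqP->|xS].
    by rewrite tpermR; apply: sB; rewrite imset_f // setU11.
  rewrite tpermD; first by apply: sB; rewrite imset_f // setU1r.
    by apply: contraNneq kS => ->.
  by apply: contraNneq lS => ->.
by apply/eqP; rewrite eqn_leq !le.
Qed.

Lemma leq_card_perms_into_setU1 (I : finType) (S B : {set I}) (i : I) :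
  i \notin S ->
  (#|I| * #|perms_into (i |: S) B| <= #|B| * #|perms_into S B|)%N.
Proof.
move=> iS.
(* Double counting of the pairs (s, j) with s mapping S into B, j outside S and
   s j in B. *)
have key : ((#|I| - #|S|) * #|perms_into (i |: S) B|
    = (#|B| - #|S|) * #|perms_into S B|)%N.
  transitivity (\sum_(j in ~: S) \sum_(s in perms_into S B) (s j \in B))%N.
    rewrite -cardsT -cardsDS ?finset.subsetT // finset.setTD -sum_nat_const.
    apply: eq_bigr => j; rewrite inE => jS.
    rewrite (card_perms_into_setU1_eq _ iS jS) -big_mkcondr /= sum1_card.
    apply: eq_card => s; rewrite !inE finset.imsetU1 finset.subUset finset.sub1set.
    by rewrite [RHS]unfold_in /= inE andbC.
  rewrite exchange_big /= mulnC -sum_nat_const; apply: eq_bigr => s.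
  rewrite inE => sSB.
  have sS : S \subset s @^-1: B.
    by apply/fintype.subsetP=> x xS; rewrite inE (fintype.subsetP sSB) ?imset_f.
  rewrite -(card_preimset B (@perm_inj _ s)) -cardsDS // -big_mkcondr sum1_card.
  by apply: eq_card => j; rewrite [LHS]unfold_in /= !inE.
have lt_SI : (#|S| < #|I|)%N.
  rewrite -cardsT proper_card // properT.
  by apply: contraNneq iS => ->; rewrite inE.
(* After multiplication by the positive number |I| - |S| and [key], it suffices that |I| (|B| - |S|)
   <= (|I| - |S|) |B|, which follows from |B| <= |I|. *)
rewrite -(@leq_pmul2l (#|I| - #|S|)) ?subn_gt0 //.
rewrite mulnCA key !mulnA leq_mul2r mulnBr mulnBl [(#|I| * #|B|)%N]mulnC.
by rewrite [(#|S| * _)%N]mulnC leq_sub2l ?orbT // leq_mul2r max_card orbT.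
Qed.

Definition hits (I : finType) (A B : {set I}) (s : {perm I}) : nat :=
  #|[set i in A | s i \in B]|.

Lemma hits_set0 (I : finType) (B : {set I}) (s : {perm I}) :
  hits finset.set0 B s = 0%N.
Proof. by apply/eqP; rewrite cards_eq0; apply/eqP/setP=> i; rewrite !inE. Qed.

(** Induction on |A| with [S] varying: removing [i] from [A] leaves the sum for [A'] plus y - 1
    times the same sum over those [s] with [s i] in [B], where [i] has joined [S]. Since y - 1 >= 0,
    an upper bound on the number of such [s] suffices. *)
Lemma sum_perms_into_expr (R : realFieldType) (I : finType) (A S B : {set I})
    (y : R) :
  1 <= y -> [disjoint A & S] ->
  \sum_(s in perms_into S B) y ^+ hits A B s <=
    #|perms_into S B|%:R * (1 + #|B|%:R / #|I|%:R * (y - 1)) ^+ #|A|.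
Proof.
move=> y1; set p := #|B|%:R / #|I|%:R; have y1' : 0 <= y - 1 by rewrite subr_ge0.
have [m] := ubnP #|A|; elim: m => // m IH in A S *; rewrite ltnS => Am AS.
have [->|/set0Pn[i iA]] := eqVneq A finset.set0.
  rewrite cards0 expr0 mulr1 (eq_bigr (fun=> 1)) ?sumr_const // => s _.
  by rewrite hits_set0.
have iS : i \notin S by rewrite (disjointFr AS).
have I0 : (0 : R) < #|I|%:R by rewrite ltr0n; apply/card_gt0P; exists i.
pose A' := A :\ i.
have cA : #|A| = #|A'|.+1 by rewrite (cardsD1 i) iA.
have A'S : [disjoint A' & S] by apply: disjointWl AS; exact: subsetDl.
have A'iS : [disjoint A' & i |: S].
  rewrite finset.setUC finset.disjoints_subset finset.setCU finset.subsetI.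
  rewrite -!finset.disjoints_subset A'S /= disjoint_sym disjoints1.
  by rewrite !inE eqxx.
have hitsE s : y ^+ hits A B s =
    y ^+ hits A' B s + (if s i \in B then (y - 1) * y ^+ hits A' B s else 0).
  rewrite /hits (cardsD1 i) !inE iA /=.
  rewrite (_ : [set _ in _ | _] :\ i = [set j in A' | s j \in B]); last first.
    by apply/setP=> j; rewrite !inE andbA.
  by case: ifP => _; rewrite ?addr0 // add1n exprS mulrBl mul1r addrC subrK.
rewrite (eq_bigr _ (fun s _ => hitsE s)) big_split /= -big_mkcondr /=.
have memU s : (s \in perms_into S B) && (s i \in B) =
    (s \in perms_into (i |: S) B).
  by rewrite !inE finset.imsetU1 finset.subUset finset.sub1set andbC.
rewrite [X in _ + X](eq_bigl _ _ memU) -mulr_sumr.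
have q0 : 0 <= 1 + p * (y - 1) by rewrite addr_ge0 // mulr_ge0 // divr_ge0.
have ltA' : (#|A'| < m)%N by rewrite -cA.
apply: le_trans
  (lerD (IH _ _ ltA' A'S) (ler_wpM2l y1' (IH _ _ ltA' A'iS))) _.
rewrite cA exprS mulrA mulrA -mulrDl ler_wpM2r ?exprn_ge0 //.
rewrite mulrDr mulr1 lerD2l mulrA mulrC ler_wpM2r // /p mulrA.
rewrite ler_pdivlMr // -!natrM ler_nat.
by rewrite mulnC [X in (_ <= X)%N]mulnC leq_card_perms_into_setU1.
Qed.

Lemma sum_perm_expr (R : realFieldType) (I : finType) (A B : {set I}) (y : R) :
  0 < y ->
  \sum_(s : {perm I}) y ^+ hits A B s <=
    #|{perm I}|%:R * (1 + #|B|%:R / #|I|%:R * (y - 1)) ^+ #|A|.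
Proof.
move=> y0.
have ge1 (C : {set I}) (z : R) : 1 <= z ->
    \sum_(s : {perm I}) z ^+ hits A C s <=
      #|{perm I}|%:R * (1 + #|C|%:R / #|I|%:R * (z - 1)) ^+ #|A|.
  move=> z1; have := @sum_perms_into_expr R I A finset.set0 C z z1.
  rewrite finset.disjoints_subset finset.setC0 finset.subsetT => /(_ isT).
  have -> : perms_into finset.set0 C = finset.setT.
    by apply/setP=> s; rewrite !inE finset.imset0 finset.sub0set.
  by rewrite cardsT; under eq_bigl do rewrite inE.
have [/ge1 // | ylt1] := leP 1 y.
(* A point of [A] guarantees |I| != 0 for the division below. *)
have [A0|/set0Pn[i iA]] := eqVneq A finset.set0.
  rewrite A0 cards0 expr0 mulr1 (eq_bigr (fun=> 1)) ?sumr_const // => s _.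
  by rewrite hits_set0.
have I0 : (#|I|%:R : R) != 0 by rewrite pnatr_eq0 -lt0n; apply/card_gt0P; exists i.
have hitsC s : y ^+ hits A B s = y ^+ #|A| * (y^-1) ^+ hits A (~: B) s.
  have -> : #|A| = (hits A B s + hits A (~: B) s)%N.
    rewrite -(cardsID [set i | s i \in B] A); congr addn; apply: eq_card => j.
      by rewrite !inE.
    by rewrite !inE andbC.
  by rewrite exprD -mulrA -exprMn mulfV ?gt_eqF // expr1n mulr1.
rewrite (eq_bigr _ (fun s _ => hitsC s)) -mulr_sumr.
have y1 : 1 <= y^-1 by rewrite invf_ge1 // ltW.
apply: le_trans (ler_wpM2l _ (ge1 (~: B) _ y1)) _; first by rewrite exprn_ge0 ?ltW.
rewrite mulrCA -exprMn.
(* Passing to the complement preserves the binomial form: with p = |B|/|I|, y (1 + (1 - p)(1/y - 1))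
   = 1 + p (y - 1). *)
suff -> : y * (1 + #|~: B|%:R / #|I|%:R * (y^-1 - 1)) =
          1 + #|B|%:R / #|I|%:R * (y - 1) by [].
have -> : (#|~: B|%:R : R) = #|I|%:R - #|B|%:R.
  by rewrite -(cardsC B) natrD addrAC subrr add0r.
by field; rewrite I0 gt_eqF.
Qed.

Lemma sum_perm_expR (R : realType) (I : finType) (A B : {set I}) (t : R) :
  \sum_(s : {perm I}) expR (t * (hits A B s)%:R) <=
    #|{perm I}|%:R * expR (#|A|%:R * #|B|%:R / #|I|%:R * (expR t - 1)).
Proof.
under eq_bigr do rewrite expRM_natr.
apply: le_trans (sum_perm_expr _ _ (expR_gt0 t)) _.
have -> : #|A|%:R * #|B|%:R / #|I|%:R * (expR t - 1) =
    #|A|%:R * (#|B|%:R / #|I|%:R * (expR t - 1)) by rewrite !mulrA.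
rewrite ler_wpM2l // expRM_natl lerXn2r ?nnegrE ?expR_ge0 //.
  (* Taking powers of 1 + x <= exp x requires a nonnegative base, hence p <= 1; for empty [I] the
     quotient is 0 by convention. *)
  have p1 : #|B|%:R / #|I|%:R <= 1 :> R.
    have [->|I0] := posnP #|I|; first by rewrite invr0 mulr0.
    by rewrite ler_pdivrMr ?ltr0n // mul1r ler_nat max_card.
  have -> (p e : R) : 1 + p * (e - 1) = (1 - p) + p * e by ring.
  by rewrite addr_ge0 ?subr_ge0 // mulr_ge0 ?divr_ge0 ?expR_ge0.
by rewrite expR_ge1Dx.
Qed.

(** * Logarithm inequalities and the two Chernoff exponents *)

Lemma is_derive_ge0_homo (R : realType) (f df : R -> R) (a x : R) :
  (forall z, a <= z -> is_derive z 1 f (df z)) ->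
  (forall z, a <= z -> 0 <= df z) -> a <= x -> f a <= f x.
Proof.
move=> fdf df0 ax; apply: (@ger0_derive1_ndecry R f a _ _ _ a x) => //.
- by move=> z; rewrite in_itv /= andbT => /ltW /fdf [].
- move=> z; rewrite in_itv /= andbT => /ltW az; rewrite derive1E.
  by have [_ ->] := fdf z az; exact: df0.
- by apply: derivable_within_continuous => z; rewrite in_itv /= andbT => /fdf [].
Qed.

(** The difference of the two sides vanishes at 1 and has derivative (z - 1)^2 / (z (z + 1)^2) >=
    0. *)
Lemma ln_ge_frac (R : realType) (y : R) :
  1 <= y -> 2 * (y - 1) / (y + 1) <= ln y.
Proof.
move=> y1; pose f z : R := ln z - 2 + 4 * (z + 1)^-1.
have : f 1 <= f y.
  apply: (@is_derive_ge0_homo R f (fun z => z^-1 - 4 * (z + 1) ^- 2)) => // z z1.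
    have z0 : 0 < z by lra.
    have zn : z + 1 != 0 by rewrite gt_eqF; lra.
    have dln := is_derive1_ln z0.
    have dV := is_deriveV (f := fun z : R => z + 1) zn.
    apply: is_derive_eq.
    by rewrite subr0 addr0 /GRing.scale /= mulr1 mulrN.
  have -> : z^-1 - 4 * (z + 1) ^- 2 = (z - 1) ^+ 2 / (z * (z + 1) ^+ 2).
    by field; rewrite !gt_eqF //; lra.
  by rewrite divr_ge0 ?sqr_ge0 // mulr_ge0 ?sqr_ge0 //; lra.
rewrite /f ln1 => h; have -> : 2 * (y - 1) / (y + 1) = 2 - 4 * (y + 1)^-1.
  by field; rewrite gt_eqF; lra.
have : (1 + 1 : R)^-1 = 1 / 2 by rewrite div1r.
by lra.
Qed.

(** The difference vanishes at 1 and has derivative (1 - 1/z)^2 / 2. *)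
Lemma ln_le_half (R : realType) (y : R) : 1 <= y -> ln y <= (y - y^-1) / 2.
Proof.
move=> y1; pose f z : R := (z - z^-1) / 2 - ln z.
suff : f 1 <= f y by rewrite /f ln1 invr1 subrr mul0r subrr subr_ge0.
apply: (@is_derive_ge0_homo R f (fun z => (1 - z^-1) ^+ 2 / 2)) => // z z1; last first.
  by rewrite divr_ge0 ?sqr_ge0.
have z0 : 0 < z by lra.
have dln := is_derive1_ln z0.
have dV := is_deriveV (f := @id R) (lt0r_neq0 z0).
apply: is_derive_eq.
rewrite /GRing.scale /=.
by field; rewrite gt_eqF.
Qed.

Lemma chernoff_upper_exponent (R : realType) (t : R) : 0 <= t ->
  t - (1 + t) * ln (1 + t) <= - (t ^+ 2 / (2 + t)).
Proof.
move=> t0; have y1 : 1 <= 1 + t by lra.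
have t2 : 0 < 2 + t by lra.
have /(ler_wpM2l (le_trans ler01 y1)) := ln_ge_frac y1.
suff -> : (1 + t) * (2 * (1 + t - 1) / (1 + t + 1)) = t + t ^+ 2 / (2 + t) by lra.
by field; rewrite !gt_eqF //; lra.
Qed.

Lemma chernoff_lower_exponent (R : realType) (t : R) : 0 <= t ->
  (1 + t)^-1 - 1 + (1 - t) * ln (1 + t) <= - (t ^+ 2 / (2 + t)).
Proof.
move=> t0; have y1 : 1 <= 1 + t by lra.
have t2 : 0 < 2 + t by lra.
have y0 : 0 < 1 + t by lra.
(* The sign of 1 - t decides whether the upper or the lower bound on ln (1 + t) applies. *)
have [t1|t1] := leP t 1.
  have t1' : 0 <= 1 - t by lra.
  have := ler_wpM2l t1' (ln_le_half y1).
  have -> : (1 - t) * ((1 + t - (1 + t)^-1) / 2) = 1 - (1 + t)^-1 - t ^+ 2 / 2.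
    by field; rewrite gt_eqF.
  have : t ^+ 2 / (2 + t) <= t ^+ 2 / 2.
    by rewrite ler_wpM2l ?sqr_ge0 // lef_pV2 ?posrE //; lra.
  lra.
have t1' : 1 - t <= 0 by lra.
have := ler_wnM2l t1' (ln_ge_frac y1).
have -> : (1 - t) * (2 * (1 + t - 1) / (1 + t + 1)) =
    1 - (1 + t)^-1 - t ^+ 2 / (2 + t) - t ^+ 3 / ((1 + t) * (2 + t)).
  by field; rewrite !gt_eqF //; lra.
have : 0 <= t ^+ 3 / ((1 + t) * (2 + t)).
  by rewrite divr_ge0 ?exprn_ge0 // mulr_ge0 // ltW.
lra.
Qed.

(** * Chernoff bound by counting tuples of permutations *)

(** Exponential Markov inequality for the counting measure. The factor [t] on both sides of the
    event makes it an upper tail for t > 0 and a lower tail for t < 0. *)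
Lemma card_sum_hits_tail (R : realType) (K I : finType) (A B : {set I})
    (t c : R) :
  #|[pred f : {ffun K -> {perm I}} |
      t * c <= t * (\sum_k hits A B (f k))%:R]|%:R <=
  #|{perm I}|%:R ^+ #|K| *
    expR (#|K|%:R * (#|A|%:R * #|B|%:R / #|I|%:R) * (expR t - 1) - t * c) :> R.
Proof.
set Q := [pred f | _]; set m := _ / _.
have -> : #|Q|%:R = \sum_(f in Q) (1 : R) by rewrite sumr_const.
apply: (@le_trans _ _ (\sum_(f : {ffun K -> {perm I}})
    expR (- (t * c)) * \prod_k expR (t * (hits A B (f k))%:R))).
  rewrite big_mkcond /=; apply: ler_sum => f _.
  rewrite -expR_sum -expRD; case: ifPn => [|_]; last exact: expR_ge0.
  rewrite inE -mulr_sumr -natr_sum => h.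
  by rewrite -[leLHS]expR0 ler_expR addrC subr_ge0.
rewrite -mulr_sumr.
(* Independence in counting form: the sum over tuples of a product is a product of sums. *)
rewrite -(bigA_distr_bigA (fun _ s => expR (t * (hits A B s)%:R))) /= prodr_const.
rewrite expRD mulrC mulrA.
rewrite ler_wpM2r ?expR_ge0 // -mulrA expRM_natl -exprMn.
by rewrite lerXn2r ?nnegrE ?mulr_ge0 ?expR_ge0 ?sum_perm_expR //;
  apply: sumr_ge0 => s _; exact: expR_ge0.
Qed.

Lemma card_sum_hits_deviation (R : realType) (K I : finType) (A B : {set I})
    (tau : R) (mu := #|K|%:R * (#|A|%:R * #|B|%:R / #|I|%:R)) :
  0 <= tau ->
  #|[pred f : {ffun K -> {perm I}} |
      tau * mu <= `|(\sum_k hits A B (f k))%:R - mu| ]|%:R <=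
  #|{perm I}|%:R ^+ #|K| * (2 * expR (- (tau ^+ 2 * mu / (2 + tau)))) :> R.
Proof.
move=> tau0; set L := ln (1 + tau).
have L0 : 0 <= L by rewrite ln_ge0 // lerDl.
have eL : expR L = 1 + tau by rewrite lnK // posrE ltr_pwDl.
have mu0 : 0 <= mu by rewrite mulr_ge0 // divr_ge0 // mulr_ge0.
(* The parameters [L] and [- L] correspond to y = 1 + tau and y = 1/(1 + tau). *)
have := lerD (card_sum_hits_tail K A B L ((1 + tau) * mu))
             (card_sum_hits_tail K A B (- L) ((1 - tau) * mu)).
rewrite -natrD -mulrDr -/mu => h.
apply: (@le_trans _ _ _ _ _ (le_trans _ h)).
  rewrite ler_nat -cardUI; apply: leq_trans (leq_addr _ _).
  apply: subset_leq_card; apply/fintype.subsetP => f.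
  rewrite !inE ler_normr => /orP[] Zf; apply/orP; [left|right].
    by rewrite ler_wpM2l //; lra.
  by rewrite !mulNr lerN2 ler_wpM2l //; lra.
rewrite ler_wpM2l ?exprn_ge0 // mulr_natl mulr2n lerD // ler_expR.
  rewrite eL.
  have := ler_wpM2l mu0 (chernoff_upper_exponent tau0).
  rewrite -/L; lra.
rewrite expRN eL.
have := ler_wpM2l mu0 (chernoff_lower_exponent tau0).
rewrite -/L; lra.
Qed.

(** * From random matrices to tuples of permutations *)

Lemma edge_count_perm_mx (R : realType) (n : nat) (s : 'S_n) (A B : {set 'I_n}) :
  edge_count (perm_mx s : 'M[R]_n) A B = (hits A B s)%:R.
Proof.
rewrite /edge_count /hits -sum1_card natr_sum.
rewrite [RHS](eq_bigl (fun i => (i \in A) && (s i \in B))) => [|i]; last by rewrite inE.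
rewrite big_mkcondr /=; apply: eq_bigr => i _.
under eq_bigr do rewrite mxE mxE.
case: ifPn => [siB|siB].
  rewrite (big_setD1 _ siB) eqxx /= big1 ?addr0 // => j.
  by rewrite !inE eq_sym => /andP[/negPf ->].
by rewrite big1 // => j jB; case: eqP => // sj; rewrite sj jB in siB.
Qed.

Lemma edge_count_sum (R : realType) (n : nat) (K : finType) (M : K -> 'M[R]_n)
    (A B : {set 'I_n}) :
  edge_count (\sum_k M k) A B = \sum_k edge_count (M k) A B.
Proof.
rewrite /edge_count [RHS]exchange_big /=; apply: eq_bigr => i _.
rewrite [RHS]exchange_big /=; apply: eq_bigr => j _.
by rewrite summxE.
Qed.

Local Open Scope classical_set_scope.
Local Open Scope ring_scope.

(** By independence each tuple [f] has probability (1/n!)^|K|; a union bound over the tuples in [Q]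
    concludes. *)
Lemma probability_perm_mx_family (R : realType) (disp : measure_display)
    (T : measurableType disp) (Pr : probability T R) (n : nat) (K : finType)
    (P : K -> T -> 'M[R]_n) (Q : pred {ffun K -> 'S_n}) :
  (forall k, uniform_perm_mx Pr (P k)) -> mutually_independent Pr P ->
  (Pr [set w | exists2 f, Q f & forall k, P k w = perm_mx (f k)] <=
    (#|Q|%:R / n`!%:R ^+ #|K|)%:E)%E.
Proof.
move=> unif indep.
pose E (f : {ffun K -> 'S_n}) : set T :=
  \bigcap_(k in [set` finset.setT : {set K}]) (P k @^-1` [set perm_mx (f k)]).
have mE f : measurable (E f).
  apply: fin_bigcap_measurable; first exact: finite_finset.
  by move=> k _; exact: ((unif k).2 (f k)).1.
have PE f : Pr (E f) = ((n`!%:R^-1) ^+ #|K|)%:E.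
  rewrite /E (indep finset.setT (fun k => [set perm_mx (f k)])).
  under eq_bigr do rewrite ((unif _).2 (f _)).2.
  rewrite prodEFin prodr_const cardsT; congr (_%:E).
have -> : [set w | exists2 f, Q f & forall k, P k w = perm_mx (f k)] =
    \bigcup_(f in [set` enum Q]) E f.
  apply/seteqP; split => w.
    by move=> [f Qf Pf]; exists f => [|k _]; [rewrite /= mem_enum|exact: Pf].
  move=> [f /= fQ Pf]; exists f; first by rewrite mem_enum in fQ.
  by move=> k; apply: Pf; rewrite /= finset.in_setT.
apply: (@le_trans _ _ (\sum_(f \in [set` enum Q]) Pr (E f))%E).
  have fin := finite_seq (enum Q).
  apply: content_sub_fsum => //; exact: fin_bigcup_measurable.
rewrite -fsbig_seq ?enum_uniq //.
under eq_bigr do rewrite PE.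
by rewrite big_enum /= sumEFin sumr_const lee_fin exprVn mulr_natl.
Qed.

Theorem theorem1p7 (R : realType) (n d : nat)
    (hn : (1 <= n)%N) (hd : (1 <= d)%N)
    (disp : measure_display) (T : measurableType disp) (Pr : probability T R)
    (P : 'I_d -> T -> 'M[R]_n)
    (hunif : forall k : 'I_d, uniform_perm_mx Pr (P k))
    (hindep : mutually_independent Pr P)
    (A B : {set 'I_n}) (tau : R) (htau : 0 <= tau) :
  let M := fun w : T => \sum_(k < d) P k w in
  let mu : R := d%:R / n%:R * #|A|%:R * #|B|%:R in
  let deviation := [set w : T | tau * mu <= `|edge_count (M w) A B - mu|] in
  ((Pr deviation <= (2 * expR (- (tau ^+ 2 * mu / (2 + tau))))%:E)%E : Prop).
Proof.
move=> M mu deviation.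
pose Q := [pred f : {ffun 'I_d -> 'S_n} |
  tau * mu <= `|(\sum_k hits A B (f k))%:R - mu|].
have -> : deviation =
    [set w | exists2 f, Q f & forall k, P k w = perm_mx (f k)].
  have edgesE (f : {ffun 'I_d -> 'S_n}) w : (forall k, P k w = perm_mx (f k)) ->
      edge_count (M w) A B = (\sum_k hits A B (f k))%:R.
    move=> Pf; rewrite edge_count_sum natr_sum.
    by apply: eq_bigr => k _; rewrite Pf edge_count_perm_mx.
  apply/seteqP; split => w /=; last first.
    by move=> [f Qf Pf]; rewrite /deviation /= (edgesE _ _ Pf).
  (* Every outcome [w] determines a tuple of permutations, so the deviation event is a condition on
     that tuple. *)
  have /choice[s Ps] k : exists s : 'S_n, P k w = perm_mx s.
    by have /is_perm_mxP := (hunif k).1 w.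
  have Pf k : P k w = perm_mx ([ffun k => s k] k) by rewrite ffunE.
  by rewrite /deviation /= (edgesE _ _ Pf) => dev; exists [ffun k => s k].
apply: le_trans (probability_perm_mx_family Q hunif hindep) _.
have := card_sum_hits_deviation 'I_d A B htau.
rewrite !card_ord card_Sn.
have -> : d%:R * (#|A|%:R * #|B|%:R / n%:R) = mu by rewrite /mu; ring.
by rewrite lee_fin ler_pdivrMr ?exprn_gt0 ?ltr0n ?fact_gt0 // [leRHS]mulrC.
Qed.
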